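(* Let $f(z)=z^{p}+\sum_{k=n}^{\infty}a_{k+p}z^{k+p}$ and $g(z)=z^{p}+\sum_{k=n}^{\infty}b_{k+p}z^{k+p}$ belong to $\mathcal{F}(\lambda,m,\Omega)$, where $p>m$. Suppose that for some real $\alpha,\beta$ with $-\pi\le\alpha-\beta\le\pi$ and some $\delta>\frac{p!}{(p-m-1)!}\sqrt{2[1-\cos(\alpha-\beta)]}$, $$\sum_{k=n}^{\infty}\frac{(k+p-m)^{\Omega+1}(k+p)!\,(1+\lambda k(p-m)^{-1})}{(p-m)^{\Omega}(k+p-m)!}\left|e^{i\alpha}a_{k+p}-e^{i\beta}b_{k+p}\right|\le\delta-\frac{p!}{(p-m-1)!}\sqrt{2[1-\cos(\alpha-\beta)]}.$$ Then $f\in(\alpha,\beta,\lambda,m,\delta,\Omega)_{p}\text{-}N(g)$.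
   Context: Let $\mathcal{U}=\{z\in\mathbb{C}:|z|<1\}$, $\mathbb{N}=\{1,2,3,\dots\}$, $\mathbb{N}_0=\mathbb{N}\cup\{0\}$. Throughout $n,p\in\mathbb{N}$, $m,\Omega\in\mathbb{N}_0$, $p>m$, $0\le\lambda\le1$, and the coefficients are complex. For $f(z)=z^{p}+\sum_{k=n}^{\infty}a_{k+p}z^{k+p}$ analytic in $\mathcal{U}$, $f^{(m)}$ is its $m$-th derivative. The (Salagean type) operator is $D^{0}f^{(m)}(z)=f^{(m)}(z)$, $D^{1}f^{(m)}(z)=\frac{z}{p-m}(f^{(m)}(z))'$, $D^{\Omega}f^{(m)}=D(D^{\Omega-1}f^{(m)})$. Define $$\mathcal{F}(f^{(m)}(z))=(1-\lambda)D^{\Omega}f^{(m)}(z)+\frac{\lambda z}{p-m}\left(D^{\Omega}f^{(m)}(z)\right)'=\frac{p!}{(p-m)!}z^{p-m}+\sum_{k=n}^{\infty}\frac{(k+p)!(k+p-m)^{\Omega}(1+\lambda k(p-m)^{-1})}{(p-m)^{\Omega}(k+p-m)!}a_{k+p}z^{k+p-m}.$$ ''$f\in\mathcal{F}(\lambda,m,\Omega)$'' means that $f(z)=z^{p}+\sum_{k\ge n}a_{k+p}z^{k+p}$ has coefficients such that this last function is analytic in $\mathcal{U}$ (equivalently, $f$ is analytic in $\mathcal{U}$). $\mathcal{F}'(f^{(m)}(z))$ denotes the derivative with respect to $z$ of $\mathcal{F}(f^{(m)}(z))$; quotients by powers of $z$ are understood at $z=0$ by removing the singularity. For $f,g\in\mathcal{F}(\lambda,m,\Omega)$,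 real $\alpha,\beta$ with $-\pi\le\alpha-\beta\le\pi$, and $\delta>\frac{p!}{(p-m-1)!}\sqrt{2[1-\cos(\alpha-\beta)]}$, one writes $f\in(\alpha,\beta,\lambda,m,\delta,\Omega)_p\text{-}N(g)$ if $$\left|\frac{e^{i\alpha}\mathcal{F}'(f^{(m)}(z))}{z^{p-m-1}}-\frac{e^{i\beta}\mathcal{F}'(g^{(m)}(z))}{z^{p-m-1}}\right|<\delta\qquad(z\in\mathcal{U}).$$ *)

(* Defs.v *)
From Stdlib Require Import Reals Factorial.
From Coquelicot Require Import Coquelicot.

Definition unit_disk (z : C) : Prop := Cmod z < 1.

Definition expi (t : R) : C := (cos t, sin t).

(* Complex differentiability at every point of an open set. *)
Definition analytic_on_disk (h : C -> C) : Prop :=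
  forall z : C, unit_disk z -> @ex_derive C_AbsRing C_NormedModule h z.

(* [f z = z^p + sum_(k >= n) a_(k+p) z^(k+p)] on the disk, with [k = n + j].
   The entries of [a] below index [n + p] are not used. *)
Definition has_expansion (n p : nat) (a : nat -> C) (f : C -> C) : Prop :=
  forall z : C, unit_disk z ->
    @is_series C_AbsRing C_NormedModule
      (fun j : nat => (a (n + j + p)%nat * z ^ (n + j + p)%nat)%C)
      (f z - z ^ p)%C.

(* [C_derive] is a total function; it is the complex derivative wherever the
   function is complex differentiable. *)
Definition derive_iter (m : nat) (f : C -> C) : C -> C := Nat.iter m C_derive f.

Definition salagean (p m : nat) (h : C -> C) (z : C) : C :=
  (z / RtoC (INR (p - m)) * C_derive h z)%C.

Definition salagean_iter (p m Omega : nat) (h : C -> C) : C -> C :=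
  Nat.iter Omega (salagean p m) h.

Definition calF (p m Omega : nat) (lambda : R) (f : C -> C) (z : C) : C :=
  let g := salagean_iter p m Omega (derive_iter m f) in
  (RtoC (1 - lambda) * g z
   + RtoC lambda * z / RtoC (INR (p - m)) * C_derive g z)%C.

Definition in_class (n p m Omega : nat) (lambda : R) (a : nat -> C)
    (f : C -> C) : Prop :=
  has_expansion n p a f /\
  analytic_on_disk f /\
  analytic_on_disk (calF p m Omega lambda f).

(* [w] is the value at [z] of [h(z) / z^q], the singularity at the origin being
   removed: at [0] the limit has to exist and to be equal to [w]. *)
Definition quotient_value (h : C -> C) (q : nat) (z w : C) : Prop :=
  (z <> RtoC 0 /\ w = (h z / z ^ q)%C) \/
  (z = RtoC 0 /\
   filterlim (fun t : C => (h t / t ^ q)%C)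
     (@locally' C_UniformSpace z) (@locally C_UniformSpace w)).

Definition delta_threshold (p m : nat) (alpha beta : R) : R :=
  INR (fact p) / INR (fact (p - m - 1)) * sqrt (2 * (1 - cos (alpha - beta))).

(* [f] is in [(alpha, beta, lambda, m, delta, Omega)_p-N(g)]. *)
Definition in_neighborhood (p m Omega : nat) (lambda alpha beta delta : R)
    (f g : C -> C) : Prop :=
  forall z : C, unit_disk z ->
    exists u v : C,
      quotient_value
        (fun t => (expi alpha * C_derive (calF p m Omega lambda f) t)%C)
        (p - m - 1) z u /\
      quotient_value
        (fun t => (expi beta * C_derive (calF p m Omega lambda g) t)%C)
        (p - m - 1) z v /\
      Cmod (u - v) < delta.

Definition coeff_term (p m Omega : nat) (lambda alpha beta : R)
    (a b : nat -> C) (k : nat) : R :=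
  INR (k + p - m) ^ (Omega + 1) * INR (fact (k + p))
    * (1 + lambda * INR k * / INR (p - m))
  / (INR (p - m) ^ Omega * INR (fact (k + p - m)))
  * Cmod (expi alpha * a (k + p)%nat - expi beta * b (k + p)%nat).

(* Main.v *)
(* Differentiating the expansion of [f] termwise gives
   [F'(f^(m)(z)) = z^(p-m-1) * Q_f(z)] with [Q_f(z) = sum_i w_i A_(i+p) z^i]
   for real weights [w_i >= 0], so [Q_f] is the quotient with its singularity
   removed. In [e^(i alpha) Q_f - e^(i beta) Q_g] the constant term has modulus
   [delta_threshold], the next ones up to [n] vanish, and the [i]-th one with
   [i >= n >= 1] is at most [|z|] times the [i]-th summand of the hypothesis.
   The factor [|z| < 1] together with [delta_threshold < delta] makes the final
   inequality strict. *)
Require Import Defs.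
From Stdlib Require Import Reals.
From Coquelicot Require Import Coquelicot.
From Stdlib Require Import Lra Lia Arith Factorial.

(** * Complex series: index shifts, norm bounds, boundedness of the terms *)

Definition power_series (c : nat -> C) (h : C -> C) : Prop :=
  forall z : C, unit_disk z ->
    @is_series C_AbsRing C_NormedModule (fun j => (c j * z ^ j)%C) (h z).

Lemma norm_C (x : C) : norm (V := C_NormedModule) x = Cmod x.
Proof. reflexivity. Qed.

Lemma is_series_eq (u v : nat -> C) (l k : C) :
  (forall j, u j = v j) -> l = k ->
  @is_series C_AbsRing C_NormedModule u l ->
  @is_series C_AbsRing C_NormedModule v k.
Proof.
  intros H <- Hu; exact (is_series_ext _ _ _ H Hu).
Qed.

Lemma is_series_Cmult (x : C) (u : nat -> C) (l : C) :
  @is_series C_AbsRing C_NormedModule u l ->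
  @is_series C_AbsRing C_NormedModule (fun j => (x * u j)%C) (x * l)%C.
Proof. exact (is_series_scal (V := C_NormedModule) x u l). Qed.

Lemma is_series_Cplus (u v : nat -> C) (l k : C) :
  @is_series C_AbsRing C_NormedModule u l ->
  @is_series C_AbsRing C_NormedModule v k ->
  @is_series C_AbsRing C_NormedModule (fun j => (u j + v j)%C) (l + k)%C.
Proof. exact (is_series_plus (V := C_NormedModule) u v l k). Qed.

Lemma is_series_C_S (u : nat -> C) (l : C) :
  @is_series C_AbsRing C_NormedModule (fun j => u (S j)) (l - u 0%nat)%C <->
  @is_series C_AbsRing C_NormedModule u l.
Proof.
  split; intros H.
  - exact (is_series_decr_1 (V := C_NormedModule) u l H).
  - apply (is_series_incr_1 (V := C_NormedModule) u).
    apply (is_series_eq u u l); [easy | | exact H].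
    change (l = (l - u 0%nat) + u 0%nat)%C; ring.
Qed.

Lemma is_series_C_drop (N : nat) (u : nat -> C) (l : C) :
  (forall j, (j < N)%nat -> u j = 0) ->
  @is_series C_AbsRing C_NormedModule (fun j => u (N + j)%nat) l <->
  @is_series C_AbsRing C_NormedModule u l.
Proof.
  revert u; induction N as [|N IH]; intros u Hu; [tauto|].
  rewrite <- (is_series_C_S u l), (Hu 0%nat) by lia.
  replace (l - 0)%C with l by ring.
  apply (IH (fun j => u (S j))).
  intros j Hj; apply Hu; lia.
Qed.

(** The triangle inequality bounds every partial sum, and a weak inequality survives the passage to
    the limit. *)
Lemma Cmod_series_le (u : nat -> C) (v : nat -> R) (l : C) (k : R) :
  (forall j, Cmod (u j) <= v j) ->
  @is_series C_AbsRing C_NormedModule u l -> is_series v k -> Cmod l <= k.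
Proof.
  intros Huv Hu Hv.
  apply (is_lim_seq_le (fun N => norm (V := C_NormedModule) (sum_n u N))
    (sum_n v) (Cmod l) k); [| |exact Hv]; cycle 1.
  { exact (filterlim_comp _ _ _ _ _ _ _ _ Hu
      (filterlim_norm (V := C_NormedModule) l)). }
  intros N; rewrite norm_C.
  induction N as [|N IH].
  - rewrite 2!sum_O; apply Huv.
  - rewrite 2!sum_Sn.
    eapply Rle_trans; [apply Cmod_triangle|].
    apply Rplus_le_compat; [exact IH | apply Huv].
Qed.

(** A term is the difference of two consecutive partial sums, and these form a convergent, hence
    bounded, sequence. *)
Lemma series_term_bounded (u : nat -> C) (l : C) :
  @is_series C_AbsRing C_NormedModule u l ->
  exists M, forall j, Cmod (u j) <= M.
Proof.
  intros Hu.
  destruct (filterlim_bounded (V := C_NormedModule) _ (ex_intro _ l Hu))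
    as [M HM].
  exists (M + M); intros j.
  assert (HM' : forall j, Cmod (sum_n (G := C_AbelianGroup) u j) <= M)
    by exact HM.
  destruct j as [|j].
  - generalize (HM' 0%nat) (Cmod_ge_0 (u 0%nat)); rewrite sum_O; lra.
  - replace (u (S j)) with (sum_n (G := C_AbelianGroup) u (S j)
      + - sum_n (G := C_AbelianGroup) u j)%C.
    + eapply Rle_trans; [apply Cmod_triangle|].
      rewrite Cmod_opp; apply Rplus_le_compat; apply HM'.
    + rewrite sum_Sn.
      change (@plus C_AbelianGroup) with Cplus; ring.
Qed.

(** * Absolute convergence inside the disk and termwise differentiation *)

Lemma unit_disk_R (r : R) : 0 <= r < 1 -> unit_disk r.
Proof. intros H; unfold unit_disk; rewrite Cmod_R, Rabs_pos_eq; lra. Qed.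

(** The terms at the midpoint [(1 + r) / 2] of [r] and [1] are bounded, so the radius is at least
    that midpoint. Passing to the moduli [Cmod (c j)] makes the theory of real power series
    available. *)
Lemma power_series_CV_radius (c : nat -> C) (h : C -> C) (r : R) :
  power_series c h -> 0 <= r < 1 ->
  Rbar_lt (Rabs r) (CV_radius (fun j => Cmod (c j))).
Proof.
  intros Hc Hr; rewrite Rabs_pos_eq by lra.
  apply Rbar_lt_le_trans with ((1 + r) / 2); [simpl; lra|].
  apply (CV_radius_bounded (fun j => Cmod (c j))).
  destruct (series_term_bounded _ _
    (Hc _ (unit_disk_R ((1 + r) / 2) ltac:(lra)))) as [M HM].
  exists M; intros j.
  specialize (HM j).
  rewrite Cmod_mult, Cmod_pow, Cmod_R in HM.
  rewrite Rabs_mult, (Rabs_pos_eq (Cmod _)), <- RPow_abs by apply Cmod_ge_0.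
  exact HM.
Qed.

Lemma ex_series_PS_derive (c : nat -> C) (h : C -> C) (r : R) :
  power_series c h -> 0 <= r < 1 ->
  ex_series (fun j => PS_derive (fun i => Cmod (c i)) j * r ^ j).
Proof.
  intros Hc Hr; apply ex_series_Rabs, CV_disk_inside.
  rewrite CV_radius_derive; eapply power_series_CV_radius; eassumption.
Qed.

Lemma ex_series_PS_derive2 (c : nat -> C) (h : C -> C) (r : R) :
  power_series c h -> 0 <= r < 1 ->
  ex_series (fun j => PS_derive (PS_derive (fun i => Cmod (c i))) j * r ^ j).
Proof.
  intros Hc Hr; apply ex_series_Rabs, CV_disk_inside.
  rewrite 2!CV_radius_derive; eapply power_series_CV_radius; eassumption.
Qed.

(* Induction on [j] through
   [E (j + 1) = w * E j + j * (w - z)^2 * z^(j - 1)]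
   for the Taylor remainder [E j = w^j - z^j - j * (w - z) * z^(j - 1)]. *)
Lemma Cpow_taylor_le (w z : C) (r : R) (j : nat) :
  Cmod w <= r -> Cmod z <= r ->
  Cmod (w ^ S (S j) - z ^ S (S j)
        - RtoC (INR (S (S j))) * (w - z) * z ^ S j)
  <= Cmod (w - z) ^ 2 * (INR (S j) * INR (S (S j)) * r ^ j).
Proof.
  intros Hw Hz.
  assert (Hr : 0 <= r) by (generalize (Cmod_ge_0 w); lra).
  induction j as [|j IH].
  - replace (w ^ 2 - z ^ 2 - RtoC (INR 2) * (w - z) * z ^ 1)%C
      with ((w - z) ^ 2)%C
      by (simpl INR; rewrite RtoC_plus; simpl Cpow; ring).
    rewrite Cmod_pow; simpl INR.
    generalize (pow2_ge_0 (Cmod (w - z))); simpl; lra.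
  - replace (w ^ S (S (S j)) - z ^ S (S (S j))
        - RtoC (INR (S (S (S j)))) * (w - z) * z ^ S (S j))%C
      with (w * (w ^ S (S j) - z ^ S (S j)
        - RtoC (INR (S (S j))) * (w - z) * z ^ S j)
        + RtoC (INR (S (S j))) * (w - z) ^ 2 * z ^ S j)%C
      by (rewrite (S_INR (S (S j))), RtoC_plus, !Cpow_S; ring).
    eapply Rle_trans; [apply Cmod_triangle|].
    rewrite !Cmod_mult, !Cmod_pow, Cmod_R, (Rabs_pos_eq (INR _))
      by apply pos_INR.
    set (d := Cmod (w - z) ^ 2) in *.
    assert (Hd : 0 <= d) by apply pow2_ge_0.
    assert (Hz' : Cmod z ^ S j <= r ^ S j)
      by (apply pow_incr; split; [apply Cmod_ge_0 | exact Hz]).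
    assert (Hrj : 0 <= r ^ S j) by (apply pow_le; exact Hr).
    apply Rle_trans with
      (r * (d * (INR (S j) * INR (S (S j)) * r ^ j))
       + INR (S (S j)) * d * r ^ S j).
    + apply Rplus_le_compat.
      * apply Rmult_le_compat; auto using Cmod_ge_0.
      * apply Rmult_le_compat_l; [|exact Hz'].
        apply Rmult_le_pos; [apply pos_INR | exact Hd].
    + rewrite (S_INR (S (S j))), (S_INR (S j)).
      generalize (pos_INR (S j)); set (x := INR (S j)); intros Hx.
      simpl pow in *.
      (* After factoring out [d * r ^ (j + 1)], this compares [(x + 1)^2] with
         [(x + 1) * (x + 2)]. *)
      apply Rminus_le.
      replace (_ - _) with (- ((x + 1) * d * (r * r ^ j))) by ring.
      assert (0 <= (x + 1) * d) by nra.
      assert (0 <= (x + 1) * d * (r * r ^ j)) by (apply Rmult_le_pos; lra).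
      lra.
Qed.

(** Summing [Cpow_taylor_le] against the moduli of the coefficients bounds the remainder by
    [K * |w - z|^2] for [|w| <= r], which is negligible against [|w - z|]. *)
Lemma power_series_is_derive (c : nat -> C) (h : C -> C) (z : C) :
  power_series c h -> unit_disk z ->
  exists D, @is_series C_AbsRing C_NormedModule
      (fun j => (RtoC (INR (S j)) * c (S j) * z ^ j)%C) D /\
    @is_derive C_AbsRing C_NormedModule h z D.
Proof.
  intros Hc Hz; pose proof Hz as Hz1; unfold unit_disk in Hz1.
  pose proof (Cmod_ge_0 z) as Hz0.
  assert (HD : @ex_series C_AbsRing C_NormedModule
      (fun j => (RtoC (INR (S j)) * c (S j) * z ^ j)%C)).
  { apply (ex_series_le (V := C_CompleteNormedModule) _
      (fun j => PS_derive (fun i => Cmod (c i)) j * Cmod z ^ j)).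
    - intros j; rewrite norm_C.
      rewrite !Cmod_mult, Cmod_pow, Cmod_R, (Rabs_pos_eq (INR _))
        by apply pos_INR.
      apply Rle_refl.
    - apply (ex_series_PS_derive c h); [exact Hc | lra]. }
  destruct HD as [D HD]; exists D; split; [exact HD|].
  (* Any [r] strictly between [|z|] and [1] leaves room for [w] around [z] and makes the constant
     [K], a second derivative series at [r], finite. *)
  set (r := (1 + Cmod z) / 2).
  assert (Hr : Cmod z < r < 1) by (unfold r; lra).
  destruct (ex_series_PS_derive2 c h r Hc ltac:(lra)) as [K HK].
  assert (Hrem : forall w, Cmod w <= r ->
    Cmod (h w - h z - (w - z) * D) <= Cmod (w - z) ^ 2 * K).
  { intros w Hw.
    apply (Cmod_series_le
      (fun j => c (S (S j)) * (w ^ S (S j) - z ^ S (S j)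
        - RtoC (INR (S (S j))) * (w - z) * z ^ S j))%C
      (fun j => Cmod (w - z) ^ 2
        * (PS_derive (PS_derive (fun i => Cmod (c i))) j * r ^ j))).
    - intros j; rewrite Cmod_mult.
      eapply Rle_trans.
      + apply Rmult_le_compat_l; [apply Cmod_ge_0|].
        apply Cpow_taylor_le; [exact Hw | lra].
      + unfold PS_derive; apply Req_le; ring.
    - assert (Hw1 : unit_disk w) by (unfold unit_disk; lra).
      (* Subtracting the series at [z] from the one at [w] cancels index 0; subtracting
         [(w - z) * D] then cancels index 1, so the remainder series starts at index 2. *)
      pose proof (Hc w Hw1) as H1.
      pose proof (is_series_Cmult (-1) _ _ (Hc z Hz)) as H2.
      pose proof (is_series_Cplus _ _ _ _ H1 H2) as H3.
      apply is_series_C_S in H3.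
      pose proof (is_series_Cplus _ _ _ _ H3
        (is_series_Cmult (- (w - z)) _ _ HD)) as H4.
      apply is_series_C_S in H4.
      refine (is_series_eq _ _ _ _ _ _ H4).
      + intros j; cbv beta; ring.
      + cbv beta; simpl Cpow; simpl INR; ring.
    - exact (is_series_scal (V := R_NormedModule) _ _ _ HK). }
  (* [is_derive] unfolds to linearity of the differential and a remainder estimate at every limit
     point of the filter, which can only be [z]. *)
  split; [exact (is_linear_scal_l (V := C_NormedModule) D)|].
  intros y Hy.
  apply (is_filter_lim_locally_unique
    (V := AbsRing_NormedModule C_AbsRing)) in Hy.
  subst y.
  intros eps.
  apply (locally_le_locally_norm (V := AbsRing_NormedModule C_AbsRing)).
  assert (HK0 : 0 <= Rabs K) by apply Rabs_pos.
  (* The first bound keeps [|w| <= r], the second gives [|w - z| * K <= eps]; the [+ 1] keeps the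
     denominator positive. *)
  assert (Hd : 0 < Rmin (r - Cmod z) (eps / (Rabs K + 1))).
  { apply Rmin_pos; [lra|].
    apply Rdiv_lt_0_compat; [apply cond_pos | lra]. }
  exists (mkposreal _ Hd); intros w Hw.
  change (Cmod (w - z) < Rmin (r - Cmod z) (eps / (Rabs K + 1))) in Hw.
  change (Cmod (h w - h z - (w - z) * D) <= eps * Cmod (w - z)).
  pose proof (Cmod_ge_0 (w - z)) as Hwz0.
  assert (Hwr : Cmod w <= r).
  { replace w with (z + (w - z))%C by ring.
    eapply Rle_trans; [apply Cmod_triangle|].
    generalize (Rmin_l (r - Cmod z) (eps / (Rabs K + 1))); lra. }
  eapply Rle_trans; [apply Hrem, Hwr|].
  assert (Hwe : Cmod (w - z) * (Rabs K + 1) <= eps).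
  { apply Rle_trans with (eps / (Rabs K + 1) * (Rabs K + 1)).
    - apply Rmult_le_compat_r; [lra|].
      generalize (Rmin_r (r - Cmod z) (eps / (Rabs K + 1))); lra.
    - right; field; lra. }
  generalize (Rle_abs K); nra.
Qed.

Lemma power_series_C_derive (c : nat -> C) (h : C -> C) :
  power_series c h ->
  power_series (fun j => (RtoC (INR (S j)) * c (S j))%C) (C_derive h).
Proof.
  intros Hc z Hz.
  destruct (power_series_is_derive c h z Hc Hz) as [D [HD Hh]].
  rewrite (is_C_derive_unique _ _ _ Hh); exact HD.
Qed.

(** Differentiability gives continuity for the neighbourhoods of [C_AbsRing]; norm balls carry it
    over to those of [C_UniformSpace]. *)
Lemma power_series_continuous (c : nat -> C) (h : C -> C) (z : C) :
  power_series c h -> unit_disk z ->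
  filterlim h (@locally C_UniformSpace z) (@locally C_UniformSpace (h z)).
Proof.
  intros Hc Hz.
  destruct (power_series_is_derive c h z Hc Hz) as [D [_ Hh]].
  intros P HP.
  apply (locally_le_locally_norm (V := C_NormedModule)).
  exact (locally_norm_le_locally (V := AbsRing_NormedModule C_AbsRing) z _
    (ex_derive_continuous (V := C_NormedModule) h z (ex_intro _ D Hh) P HP)).
Qed.

(** * Action of the operators on Taylor coefficients *)

Lemma power_series_ext (c d : nat -> C) (h : C -> C) :
  (forall j, c j = d j) -> power_series c h -> power_series d h.
Proof.
  intros H Hc z Hz; refine (is_series_eq _ _ _ _ _ eq_refl (Hc z Hz)).
  intros j; cbv beta; now rewrite H.
Qed.

Lemma power_series_scal (x : C) (c : nat -> C) (h : C -> C) :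
  power_series c h ->
  power_series (fun j => (x * c j)%C) (fun z => (x * h z)%C).
Proof.
  intros Hc z Hz.
  refine (is_series_eq _ _ _ _ _ eq_refl (is_series_Cmult x _ _ (Hc z Hz))).
  intros j; cbv beta; ring.
Qed.

Lemma power_series_plus (c d : nat -> C) (h k : C -> C) :
  power_series c h -> power_series d k ->
  power_series (fun j => (c j + d j)%C) (fun z => (h z + k z)%C).
Proof.
  intros Hc Hd z Hz.
  refine (is_series_eq _ _ _ _ _ eq_refl
    (is_series_Cplus _ _ _ _ (Hc z Hz) (Hd z Hz))).
  intros j; cbv beta; ring.
Qed.

(** The Euler operator is diagonal on monomials; the Salagean operator and the [lambda] term of
    [calF] are multiples of it. *)
Lemma power_series_euler (c : nat -> C) (h : C -> C) :
  power_series c h ->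
  power_series (fun j => (RtoC (INR j) * c j)%C) (fun z => (z * C_derive h z)%C).
Proof.
  intros Hc z Hz.
  apply is_series_C_S.
  refine (is_series_eq _ _ _ _ _ _
    (is_series_Cmult z _ _ (power_series_C_derive _ _ Hc z Hz))).
  - intros j; cbv beta; rewrite Cpow_S; ring.
  - simpl INR; ring.
Qed.

Lemma power_series_derive_iter (m : nat) (c : nat -> C) (h : C -> C) :
  power_series c h ->
  power_series
    (fun j => (RtoC (INR (fact (j + m)) / INR (fact j)) * c (j + m)%nat)%C)
    (derive_iter m h).
Proof.
  intros Hc; induction m as [|m IH].
  - refine (power_series_ext _ _ _ _ Hc); intros j.
    rewrite Nat.add_0_r; unfold Rdiv; rewrite Rinv_r by apply INR_fact_neq_0.
    ring.
  - refine (power_series_ext _ _ _ _ (power_series_C_derive _ _ IH)).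
    intros j; cbv beta.
    replace (S j + m)%nat with (j + S m)%nat by lia.
    rewrite Cmult_assoc, <- RtoC_mult; f_equal; f_equal.
    rewrite (fact_simpl j), mult_INR.
    field; split; [apply INR_fact_neq_0 | apply not_0_INR; lia].
Qed.

Lemma power_series_salagean_iter (p m Omega : nat) (c : nat -> C) (h : C -> C) :
  (m < p)%nat -> power_series c h ->
  power_series (fun j => (RtoC ((INR j / INR (p - m)) ^ Omega) * c j)%C)
    (salagean_iter p m Omega h).
Proof.
  intros hpm Hc; induction Omega as [|W IH].
  - refine (power_series_ext _ _ _ _ Hc); intros j; simpl; ring.
  - intros z Hz.
    refine (is_series_eq _ _ _ _ _ _ (power_series_scal
      (RtoC (/ INR (p - m))) _ _ (power_series_euler _ _ IH) z Hz)).
    + intros j; cbv beta; simpl pow; unfold Rdiv; rewrite !RtoC_mult; ring.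
    + unfold salagean_iter; simpl Nat.iter; unfold salagean at 2.
      rewrite RtoC_inv by (apply not_0_INR; lia).
      unfold Cdiv; ring.
Qed.

(** The three factors come, left to right, from the combination with [lambda], the [Omega] Salagean
    steps and the [m] derivatives. *)
Lemma power_series_calF (p m Omega : nat) (lambda : R) (c : nat -> C)
    (h : C -> C) :
  (m < p)%nat -> power_series c h ->
  power_series
    (fun j => (RtoC ((1 - lambda + lambda * INR j / INR (p - m))
       * (INR j / INR (p - m)) ^ Omega
       * (INR (fact (j + m)) / INR (fact j))) * c (j + m)%nat)%C)
    (calF p m Omega lambda h).
Proof.
  intros hpm Hc z Hz.
  pose proof (power_series_salagean_iter p m Omega _ _ hpm
    (power_series_derive_iter m c h Hc)) as Hg.
  refine (is_series_eq _ _ _ _ _ _ (power_series_plus _ _ _ _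
    (power_series_scal (RtoC (1 - lambda)) _ _ Hg)
    (power_series_scal (RtoC (lambda / INR (p - m))) _ _
      (power_series_euler _ _ Hg)) z Hz)).
  - intros j; cbv beta; unfold Rdiv; rewrite !RtoC_mult, RtoC_plus, !RtoC_mult.
    ring.
  - unfold calF, Rdiv; rewrite RtoC_mult.
    rewrite RtoC_inv by (apply not_0_INR; lia).
    unfold Cdiv; ring.
Qed.

(** * Weights, and the factorisation of the derivative of [calF] *)

(** The factor in front of the modulus in [coeff_term]. *)
Definition weight (p m Omega : nat) (lambda : R) (k : nat) : R :=
  INR (k + p - m) ^ (Omega + 1) * INR (fact (k + p))
    * (1 + lambda * INR k * / INR (p - m))
  / (INR (p - m) ^ Omega * INR (fact (k + p - m))).

(** The right side is the coefficient of [calF] at exponent [k + p - m], times that exponent, which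
    the outer derivative brings down. The key identity is [1 - lambda + lambda (k+p-m)/(p-m) = 1 +
    lambda k/(p-m)]. *)
Lemma weight_eq (p m Omega : nat) (lambda : R) (k : nat) :
  (m < p)%nat ->
  weight p m Omega lambda k = INR (k + p - m)
    * ((1 - lambda + lambda * INR (k + p - m) / INR (p - m))
       * (INR (k + p - m) / INR (p - m)) ^ Omega
       * (INR (fact (k + p)) / INR (fact (k + p - m)))).
Proof.
  intros hpm; unfold weight, Rdiv.
  assert (E : INR (k + p - m) = INR k + INR (p - m))
    by (rewrite <- plus_INR; f_equal; lia).
  assert (INR (p - m) <> 0) by (apply not_0_INR; lia).
  rewrite Rpow_mult_distr, pow_inv, pow_add.
  generalize (INR (k + p - m) ^ Omega); intros x; rewrite E.
  field; repeat split; auto using INR_fact_neq_0, pow_nonzero.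
Qed.

(** Merges the leading [z^p] and the tail into one Taylor sequence from index 0, to which termwise
    operations apply uniformly. *)
Definition full_coeff (n p : nat) (a : nat -> C) (j : nat) : C :=
  if (j =? p)%nat then RtoC 1 else if (n + p <=? j)%nat then a j else RtoC 0.

Lemma full_coeff_lead (n p : nat) (a : nat -> C) : full_coeff n p a p = RtoC 1.
Proof. unfold full_coeff; now rewrite Nat.eqb_refl. Qed.

Lemma full_coeff_tail (n p : nat) (a : nat -> C) (j : nat) :
  (1 <= n)%nat -> (n + p <= j)%nat -> full_coeff n p a j = a j.
Proof.
  intros hn hj; unfold full_coeff.
  destruct (Nat.eqb_spec j p); [lia|].
  destruct (Nat.leb_spec (n + p) j); [reflexivity | lia].
Qed.

Lemma full_coeff_gap (n p : nat) (a : nat -> C) (j : nat) :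
  j <> p -> (j < n + p)%nat -> full_coeff n p a j = RtoC 0.
Proof.
  intros hj hj'; unfold full_coeff.
  destruct (Nat.eqb_spec j p); [lia|].
  destruct (Nat.leb_spec (n + p) j); [lia | reflexivity].
Qed.

Lemma has_expansion_power_series (n p : nat) (a : nat -> C) (f : C -> C) :
  (1 <= n)%nat -> has_expansion n p a f -> power_series (full_coeff n p a) f.
Proof.
  intros hn Hf z Hz.
  (* Three blocks precede the tail: [p] zeros, the leading coefficient, then [n - 1] zeros. *)
  apply (is_series_C_drop p).
  { intros j hj; rewrite full_coeff_gap by lia; ring. }
  apply is_series_C_S, (is_series_C_drop (n - 1)).
  { intros j hj; rewrite full_coeff_gap by lia; ring. }
  refine (is_series_eq _ _ _ _ _ _ (Hf z Hz)).
  - intros j; cbv beta.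
    replace (p + S (n - 1 + j))%nat with (n + j + p)%nat by lia.
    now rewrite full_coeff_tail by lia.
  - rewrite Nat.add_0_r, full_coeff_lead; ring.
Qed.

Lemma C_derive_calF_factor (n p m Omega : nat) (lambda : R) (a : nat -> C)
    (f : C -> C) :
  (1 <= n)%nat -> (m < p)%nat -> has_expansion n p a f ->
  exists Q, power_series
      (fun i => (RtoC (weight p m Omega lambda i) * full_coeff n p a (i + p))%C)
      Q /\
    forall z, unit_disk z ->
      C_derive (calF p m Omega lambda f) z = (z ^ (p - m - 1) * Q z)%C.
Proof.
  intros hn hpm Hf.
  pose proof (power_series_C_derive _ _ (power_series_calF p m Omega lambda _ _
    hpm (has_expansion_power_series n p a f hn Hf))) as HF.
  set (q := (fun i =>
    (RtoC (weight p m Omega lambda i) * full_coeff n p a (i + p))%C)).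
  set (F' := C_derive (calF p m Omega lambda f)) in *.
  assert (Hq : forall z, unit_disk z -> @is_series C_AbsRing C_NormedModule
      (fun i => (z ^ (p - m - 1) * (q i * z ^ i))%C) (F' z)).
  { intros z Hz.
    pose proof (HF z Hz) as Hs.
    (* Terms of index below [p - m - 1] carry coefficients of index below [p], hence vanish. *)
    apply (is_series_C_drop (p - m - 1)) in Hs.
    - refine (is_series_eq _ _ _ _ _ eq_refl Hs).
      intros i; cbv beta; unfold q.
      replace (S (p - m - 1 + i) + m)%nat with (i + p)%nat by lia.
      replace (S (p - m - 1 + i)) with (i + p - m)%nat by lia.
      rewrite Cpow_add_r.
      rewrite (Cmult_assoc (RtoC (INR _))), <- RtoC_mult.
      rewrite (weight_eq p m Omega lambda i hpm); ring.
    - intros j hj; cbv beta; rewrite full_coeff_gap by lia; ring. }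
  (* At the origin the quotient may be 0/0, so the constant coefficient is taken there. *)
  exists (fun z => if Ceq_dec z 0 then q 0%nat else (F' z / z ^ (p - m - 1))%C).
  (* At the origin only index 0 survives. The scalar [l] serves twice: [1] for the value of [Q],
     [0 ^ (p - m - 1)] for the factorisation. *)
  assert (HQ0 : forall l, @is_series C_AbsRing C_NormedModule
      (fun i => (l * (q i * 0 ^ i))%C) (l * q 0%nat)%C).
  { intros l; apply is_series_C_S.
    (* The zero series is obtained as 0 times a series known to converge. *)
    refine (is_series_eq _ _ _ _ _ _ (is_series_Cmult 0 _ _
      (Hq _ (unit_disk_R 0 ltac:(lra))))); intros; simpl; ring. }
  split; intros z Hz; destruct (Ceq_dec z 0) as [->|Hz0].
  - refine (is_series_eq _ _ _ _ _ _ (HQ0 1)); intros; ring.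
  - refine (is_series_eq _ _ _ _ _ _
      (is_series_Cmult (/ z ^ (p - m - 1)) _ _ (Hq _ Hz))).
    + intros i; cbv beta; field; now apply Cpow_nz.
    + unfold Cdiv; ring.
  - exact (filterlim_locally_unique (V := C_NormedModule) _ _ _ (Hq 0 Hz)
      (HQ0 (0 ^ (p - m - 1))%C)).
  - field; now apply Cpow_nz.
Qed.

(** Off the origin the power cancels; at the origin the quotient agrees with [Q] on the punctured
    disk, and continuity of [Q] gives the limit. *)
Lemma quotient_value_factor (h Q : C -> C) (c : nat -> C) (q : nat) (z : C) :
  power_series c Q ->
  (forall t, unit_disk t -> h t = (t ^ q * Q t)%C) ->
  unit_disk z -> quotient_value h q z (Q z).
Proof.
  intros HQ Hh Hz; destruct (Ceq_dec z 0) as [->|Hz0]; [right | left];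
    (split; [assumption || reflexivity|]).
  - apply filterlim_ext_loc with Q.
    + apply (locally_le_locally_norm (V := C_NormedModule)).
      exists (mkposreal 1 Rlt_0_1).
      change (forall t : C, Cmod (t - RtoC 0) < 1 -> t <> 0 ->
        Q t = (h t / t ^ q)%C).
      intros t Ht Ht0; replace (t - RtoC 0)%C with t in Ht by ring.
      rewrite (Hh t Ht); field; now apply Cpow_nz.
    + eapply filterlim_filter_le_1; [|exact (power_series_continuous c Q 0 HQ Hz)].
      intros P [e He]; exists e; intros t Ht _; apply He, Ht.
  - rewrite (Hh z Hz); field; now apply Cpow_nz.
Qed.

(** * The constant term and the final estimate *)

(** Source of the root in [delta_threshold]: in the squared modulus the two Pythagorean identities
    contribute 2 and the cross terms form the cosine of the difference. *)
Lemma Cmod_expi_minus (alpha beta : R) :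
  Cmod (expi alpha - expi beta) = sqrt (2 * (1 - cos (alpha - beta))).
Proof.
  unfold Cmod; simpl; f_equal; rewrite cos_minus.
  generalize (sin2_cos2 alpha) (sin2_cos2 beta); unfold Rsqr; nra.
Qed.

Lemma weight_0 (p m Omega : nat) (lambda : R) :
  (m < p)%nat ->
  weight p m Omega lambda 0 = INR (fact p) / INR (fact (p - m - 1)).
Proof.
  intros hpm; unfold weight; simpl Nat.add; simpl (INR 0).
  assert (Hs : (p - m)%nat = S (p - m - 1)) by lia.
  assert (INR (p - m) <> 0) by (apply not_0_INR; lia).
  rewrite pow_add; rewrite Hs at 5; rewrite fact_simpl, mult_INR, <- Hs.
  field; repeat split; auto using INR_fact_neq_0, pow_nonzero.
Qed.

Lemma weight_ge_0 (p m Omega : nat) (lambda : R) (k : nat) :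
  (m < p)%nat -> 0 <= lambda -> 0 <= weight p m Omega lambda k.
Proof.
  intros hpm hl.
  assert (0 < INR (p - m)) by (apply lt_0_INR; lia).
  apply Rmult_le_pos.
  - repeat apply Rmult_le_pos; auto using pos_INR, pow_le.
    apply Rplus_le_le_0_compat; [lra|].
    repeat apply Rmult_le_pos; auto using pos_INR.
    left; now apply Rinv_0_lt_compat.
  - left; apply Rinv_0_lt_compat, Rmult_lt_0_compat;
      [now apply pow_lt | apply INR_fact_lt_0].
Qed.

Lemma is_series_head_gap (v : nat -> R) (n : nat) (l : R) :
  (1 <= n)%nat -> (forall k, (1 <= k < n)%nat -> v k = 0) ->
  is_series (fun j => v (n + j)%nat) l -> is_series v (v 0%nat + l).
Proof.
  intros hn Hv Hl.
  apply is_series_decr_n with n; [lia|].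
  replace (plus _ _) with l; [exact Hl|].
  assert (H : forall k, (k < n)%nat -> sum_n v k = v 0%nat).
  { induction k as [|k IH]; intros hk; [apply sum_O|].
    rewrite sum_Sn, IH, (Hv (S k)) by lia.
    change (v 0%nat + 0 = v 0%nat); ring. }
  change (l = v 0%nat + l + - sum_n v (Init.Nat.pred n)).
  rewrite H by lia; ring.
Qed.

Theorem theorem2p1
  (n p m Omega : nat) (lambda : R)
  (hn : (1 <= n)%nat) (hp : (1 <= p)%nat) (hpm : (m < p)%nat)
  (hlambda : 0 <= lambda <= 1)
  (a b : nat -> C) (f g : C -> C)
  (hf : in_class n p m Omega lambda a f)
  (hg : in_class n p m Omega lambda b g)
  (alpha beta delta : R)
  (hab : - PI <= alpha - beta <= PI)
  (hdelta : delta_threshold p m alpha beta < delta)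
  (hconv : ex_series
     (fun j : nat => coeff_term p m Omega lambda alpha beta a b (n + j)))
  (hsum : Series
     (fun j : nat => coeff_term p m Omega lambda alpha beta a b (n + j))
     <= delta - delta_threshold p m alpha beta) :
  in_neighborhood p m Omega lambda alpha beta delta f g.
Proof.
  intros z Hz.
  destruct hf as [hf _], hg as [hg _].
  destruct (C_derive_calF_factor n p m Omega lambda a f hn hpm hf)
    as [Qf [HQf Hf]].
  destruct (C_derive_calF_factor n p m Omega lambda b g hn hpm hg)
    as [Qg [HQg Hg]].
  apply (power_series_scal (expi alpha)) in HQf.
  apply (power_series_scal (expi beta)) in HQg.
  exists (expi alpha * Qf z)%C, (expi beta * Qg z)%C; split; [|split].
  - refine (quotient_value_factor _ _ _ _ z HQf _ Hz).
    intros t Ht; rewrite (Hf t Ht); ring.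
  - refine (quotient_value_factor _ _ _ _ z HQg _ Hz).
    intros t Ht; rewrite (Hg t Ht); ring.
  - set (W := weight p m Omega lambda) in *.
    set (T := delta_threshold p m alpha beta) in *.
    set (S := Series _) in hsum.
    set (A := full_coeff n p a) in *; set (B := full_coeff n p b) in *.
    pose proof (Cmod_ge_0 z) as Hz0; unfold unit_disk in Hz.
    (* Majorant of the termwise difference: [|z|^i] is weakened to [|z|] for [i >= 1] and is [1] at
       [i = 0]. *)
    set (v := fun i => W i
      * Cmod (expi alpha * A (i + p)%nat - expi beta * B (i + p)%nat)
      * (if (i =? 0)%nat then 1 else Cmod z)).
    assert (Hv0 : v 0%nat = T).
    { unfold v, T, W, A, B, delta_threshold.
      rewrite weight_0, !full_coeff_lead, !Cmult_1_r, Cmod_expi_minus by lia.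
      simpl; ring. }
    (* [|z| * S <= |z| * (delta - T) < delta - T], strict because [delta - T > 0]. *)
    apply Rle_lt_trans with (T + Cmod z * S); [|nra].
    rewrite <- Hv0.
    apply (Cmod_series_le (fun i => RtoC (W i)
      * (expi alpha * A (i + p)%nat - expi beta * B (i + p)%nat) * z ^ i)%C v).
    + intros i; unfold v.
      rewrite !Cmod_mult, Cmod_R, Cmod_pow, Rabs_pos_eq
        by (apply weight_ge_0; lia || lra).
      apply Rmult_le_compat_l.
      { apply Rmult_le_pos; [apply weight_ge_0; lia || lra | apply Cmod_ge_0]. }
      destruct i as [|i]; [apply Rle_refl|].
      simpl; rewrite <- (Rmult_1_r (Cmod z)) at 3.
      apply Rmult_le_compat_l; [lra|].
      rewrite <- (pow1 i); apply pow_incr; lra.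
    + refine (is_series_eq _ _ _ _ _ _ (is_series_Cplus _ _ _ _ (HQf z Hz)
        (is_series_Cmult (-1) _ _ (HQg z Hz)))); intros; cbv beta; ring.
    + apply is_series_head_gap with n; [lia | |].
      * intros k hk; unfold v, A, B; rewrite !full_coeff_gap by lia.
        rewrite !Cmult_0_r; unfold Cminus; rewrite Cplus_opp_r, Cmod_0; ring.
      (* Since [n >= 1], the index [n + j] is never 0 and the factor in [v] is always [|z|]. *)
      * assert (Hv : forall j, Cmod z
            * coeff_term p m Omega lambda alpha beta a b (n + j) = v (n + j)%nat).
        { intros j; unfold v, A, B, coeff_term; rewrite !full_coeff_tail by lia.
          destruct (Nat.eqb_spec (n + j) 0); [lia|].
          unfold W, weight; ring. }
        apply (is_series_ext _ _ _ Hv).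
        exact (is_series_scal (V := R_NormedModule) _ _ _
          (Series_correct _ hconv)).
Qed.
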